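(* Let $n\ge1$ and $C_n=Q_n-Q_{n-1}$ (a polynomial in $\mu_1,\dots,\mu_n$). Then the real affine varieties $\mathbf V(C_n)$ and $\mathbf V(Q_n)$ in $\mathbb R^n$ are related by $$\mathbf V(C_n)=(\underbrace{0,\dots,0}_{n-1},1)+\mathbf V(Q_n).$$ In particular, $\mathbf V(C_n)$ is the disjoint union of $n$ smooth surfaces $$\mathbf V(C_n)=\bigcup_{k=0}^{n-1}\mathrm{Graph}\big((\Phi_{n-1}+1)|_{D_k^{(n-1)}}\big),$$ and its complement in $\mathbb R^n$ is a disjoint union of $n+1$ unbounded path-connected open components $$(\mathbf V(C_n))^c=\bigcup_{k=0}^nG_k^{(n)},\qquad G_k^{(n)}=(\underbrace{0,\dots,0}_{n-1},1)+D_k^{(n)},\quad k=0,1,\dots,n.$$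
   Context: For a real polynomial $f$ in $n$ variables, $\mathbf V(f)=\{\mu\in\mathbb R^n:f(\mu)=0\}$. The real polynomials $Q_n=Q_n(\mu_1,\dots,\mu_n)$ are defined by $Q_0=1$, $Q_1(\mu_1)=1+\mu_1$, and $Q_{n+1}=(2+\mu_{n+1})Q_n-Q_{n-1}$ for $n\ge1$. ($C_n$ is the value at the lower spectral threshold of the Jost function of the Jacobi operator with diagonal perturbation $\mathrm{diag}(2\mu_1,\mu_2,\dots,\mu_n,0,\dots)$.) For $n\ge 1$, $\Phi_n=Q_{n-1}/Q_n-2$ with domain $\mathrm{Dom}(\Phi_n)=\{\mu\in\mathbb R^n: Q_n(\mu)\neq0\}$. For a real function $f$, $\mathrm{epi}(f)=\{(x,y)\in\mathrm{Dom}(f)\times\mathbb R: y>f(x)\}$ and $\mathrm{hypo}(f)=\{(x,y)\in\mathrm{Dom}(f)\times\mathbb R: y<f(x)\}$. The subsets $D_k^{(n)}\subset\mathrm{Dom}(\Phi_n)\subset\mathbb R^n$, $0\le k\le n$, are defined inductively, with $\Gamma_k^{(n)}\subset\mathbb R^{n+1}$ denoting the graph of $\Phi_n|_{D_k^{(n)}}$. Convention for $n=0$: $D_0^{(0)}=\mathbb R^0$ is a point, $\Phi_0=-1$, so $\Gamma_0^{(0)}=\{-1\}\subset\mathbb R$. For $n=1$: $D_0^{(1)}=(-1,\infty)$, $D_1^{(1)}=(-\infty,-1)$. For $n\ge1$: $D_0^{(n+1)}=\mathrm{epi}(\Phi_n|_{D_0^{(n)}})$; $D_{n+1}^{(n+1)}=\mathrm{hypo}(\Phi_n|_{D_n^{(n)}})$;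 and for $1\le k\le n$, $D_k^{(n+1)}=\mathrm{hypo}(\Phi_n|_{D_{k-1}^{(n)}})\cup(\Gamma_{k-1}^{(n-1)}\times\mathbb R)\cup\mathrm{epi}(\Phi_n|_{D_k^{(n)}})$. *)

(* Defs.v *)
From HB Require Import structures.
From mathcomp Require Import all_boot all_order all_algebra.
(* mpoly's notations clash with those of MathComp-Analysis. *)
From mathcomp Require Import -(notations) mpoly.
From mathcomp Require Import all_classical all_reals all_analysis.

Set Implicit Arguments.
Unset Strict Implicit.
Unset Printing Implicit Defensive.

Import Order.TTheory GRing.Theory Num.Theory.
Import numFieldNormedType.Exports.

Local Open Scope classical_set_scope.
Local Open Scope ring_scope.

(* R^(n+1) = R^n x R : a row vector mu of size n+1 is the pair
   (rv_init mu, rv_last mu). *)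
Definition rv_init (R : realType) (n : nat) (mu : 'rV[R]_n.+1) : 'rV[R]_n :=
  \row_(i < n) mu 0 (widen_ord (leqnSn n) i).

Definition rv_last (R : realType) (n : nat) (mu : 'rV[R]_n.+1) : R :=
  mu 0 ord_max.

Definition e_last (R : realType) (n : nat) : 'rV[R]_n.+1 := delta_mx 0 ord_max.

(* mwiden p is p seen as a polynomial in one more variable; 'X_i is
   mpolyX R (mnm1 i). *)
Fixpoint Q (R : realType) (n : nat) : mpoly n R :=
  match n return mpoly n R with
  | 0 => 1
  | n'.+1 =>
    match n' return mpoly n' R -> mpoly n'.+1 R with
    | 0 => fun _ => 1 + mpolyX R (mnm1 ord_max)
    | m.+1 => fun Qm1 =>
        (2%:R + mpolyX R (mnm1 ord_max)) * mwiden Qm1 - mwiden (mwiden (Q R m))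
    end (Q R n')
  end.

(* C R n is C_(n+1). *)
Definition C (R : realType) (n : nat) : mpoly n.+1 R :=
  Q R n.+1 - mwiden (Q R n).

Definition peval (R : realType) (n : nat) (p : mpoly n R) (mu : 'rV[R]_n) : R :=
  meval (mu 0) p.

Definition V (R : realType) (n : nat) (p : mpoly n R) : set 'rV[R]_n :=
  [set mu | peval p mu = 0].

(* Real functions defined on a subset of R^n: values outside dom are junk. *)
Record pfun (R : realType) (n : nat) := PFun {
  dom : set 'rV[R]_n;
  pval : 'rV[R]_n -> R }.

Section PartialFunctions.
Variables (R : realType) (n : nat).
Implicit Types (f : pfun R n) (D : set 'rV[R]_n).

Definition prestrict f D : pfun R n := PFun (dom f `&` D) (pval f).

Definition paddc f (c : R) : pfun R n := PFun (dom f) (fun x => pval f x + c).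

Definition graph f : set 'rV[R]_n.+1 :=
  [set mu | dom f (rv_init mu) /\ rv_last mu = pval f (rv_init mu)].

Definition epi f : set 'rV[R]_n.+1 :=
  [set mu | dom f (rv_init mu) /\ rv_last mu > pval f (rv_init mu)].

Definition hypo f : set 'rV[R]_n.+1 :=
  [set mu | dom f (rv_init mu) /\ rv_last mu < pval f (rv_init mu)].

(* A x R, as a subset of R^(n+1) *)
Definition cylinder D : set 'rV[R]_n.+1 := [set mu | D (rv_init mu)].

End PartialFunctions.

Definition Phi (R : realType) (n : nat) : pfun R n :=
  match n return pfun R n with
  | 0 => PFun setT (fun _ => -1)
  | m.+1 => PFun [set mu | peval (Q R m.+1) mu != 0]
      (fun mu => peval (mwiden (Q R m)) mu / peval (Q R m.+1) mu - 2)
  end.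

(* D R n k is D_k^(n) for k <= n, and is empty for k > n. *)
Fixpoint D (R : realType) (n : nat) : nat -> set 'rV[R]_n :=
  match n return nat -> set 'rV[R]_n with
  | 0 => fun k => if k is 0 then setT else set0
  | n'.+1 =>
    match n' return (nat -> set 'rV[R]_n') -> nat -> set 'rV[R]_n'.+1 with
    | 0 => fun _ k =>
        match k with
        | 0 => [set mu | rv_last mu > -1]
        | 1 => [set mu | rv_last mu < -1]
        | _ => set0
        end
    | m.+1 => fun Dm1 k =>
        match k with
        | 0 => epi (prestrict (Phi R m.+1) (Dm1 0%N))
        | k'.+1 =>
          if k' == m.+1 then hypo (prestrict (Phi R m.+1) (Dm1 m.+1))
          else if (k' < m.+1)%N then
            hypo (prestrict (Phi R m.+1) (Dm1 k'))
            `|` cylinder (graph (prestrict (Phi R m) (@D R m k')))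
            `|` epi (prestrict (Phi R m.+1) (Dm1 k'.+1))
          else set0
        end
    end (@D R n')
  end.
Arguments D : clear implicits.

(* G R n k is G_k^(n+1). *)
Definition G (R : realType) (n k : nat) : set 'rV[R]_n.+1 :=
  [set e_last R n + mu | mu in D R n.+1 k].
Arguments G : clear implicits.

(* f is of class C^r on the open set U: all its iterated partial derivatives
   up to order r exist and are continuous on U. *)
Fixpoint class_C (R : realType) (n : nat) (r : nat) (U : set 'rV[R]_n)
    (f : 'rV[R]_n -> R) : Prop :=
  {in U, continuous f} /\
  match r with
  | 0 => True
  | r'.+1 => forall i : 'I_n,
      (forall x, U x -> derivable f x (delta_mx 0 i)) /\
      class_C r' U (fun x => 'D_(delta_mx 0 i) f x)
  end.

Definition smooth_on (R : realType) (n : nat) (U : set 'rV[R]_n)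
    (f : 'rV[R]_n -> R) : Prop := forall r, class_C r U f.

(* Nonempty embedded C^oo submanifold of codimension 1 of R^n: locally the
   zero set of a C^oo function whose gradient does not vanish on it. *)
Definition smooth_hypersurface (R : realType) (n : nat) (S : set 'rV[R]_n) :
    Prop :=
  S !=set0 /\
  forall p, S p -> exists (U : set 'rV[R]_n) (f : 'rV[R]_n -> R),
    [/\ open U, U p, smooth_on U f,
        S `&` U = [set x | U x /\ f x = 0] &
        forall x, S x -> U x ->
          exists i : 'I_n, 'D_(delta_mx 0 i) f x != 0].

Definition path_connected (R : realType) (T : topologicalType) (A : set T) :
    Prop :=
  forall x y, A x -> A y -> exists gamma : R -> T,
    [/\ {within `[0, 1], continuous gamma}, gamma 0 = x, gamma 1 = y &
        forall t, t \in `[0, 1] -> A (gamma t)].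

(* Main.v *)
Require Import Defs.
From HB Require Import structures.
From mathcomp Require Import all_boot all_order all_algebra.
From mathcomp Require Import -(notations) mpoly.
From mathcomp Require Import all_classical all_reals all_analysis.
From mathcomp Require Import ring lra zify.

Set Implicit Arguments.
Unset Strict Implicit.
Unset Printing Implicit Defensive.

Import Order.TTheory GRing.Theory Num.Theory.
Import numFieldNormedType.Exports.

Local Open Scope classical_set_scope.
Local Open Scope ring_scope.

(* By induction, D_k^(n) is the set of mu with Q_n(mu) != 0 at which the
   sequence Q_0, ..., Q_n has exactly k sign changes.  As consecutive terms do
   not vanish together, this number is locally constant where Q_n != 0: a zero
   Q_j = 0 inside the sequence separates terms of opposite signs, so it stands
   for exactly one sign change even after perturbation.  Hence the D_k^(n) are
   open and partition the complement of V(Q_n), and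
   Q_(n+1) = Q_n * (mu_(n+1) - Phi_n) turns V(Q_(n+1)) into the union of the
   graphs of Phi_n over them.  For path-connectedness, D_k^(n+1) is the union of
   an epigraph and a hypograph over path-connected sets, glued along the points
   with Q_n = 0: a short segment through such a point leads into both parts.  Everything is transported to
   C_n by C_n(e + mu) = Q_n(mu). *)

(** * Sign changes of the sequence Q_0, ..., Q_n and the regions D_k^(n) *)

Section SignChanges.
Variable R : realType.

Definition rv_snoc (n : nat) (x : 'rV[R]_n) (y : R) : 'rV[R]_n.+1 :=
  \row_j if unlift ord_max j is Some i then x 0 i else y.

Lemma widen_ord_lift_max n (i : 'I_n) :
  widen_ord (leqnSn n) i = lift ord_max i.
Proof. by apply: val_inj; rewrite /= /bump leqNgt ltn_ord. Qed.

Lemma rv_init_snoc n (x : 'rV[R]_n) y : rv_init (rv_snoc x y) = x.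
Proof. by apply/rowP => i; rewrite !mxE widen_ord_lift_max liftK. Qed.

Lemma rv_last_snoc n (x : 'rV[R]_n) y : rv_last (rv_snoc x y) = y.
Proof. by rewrite /rv_last mxE unlift_none. Qed.

Lemma rv_snoc_eta n (mu : 'rV[R]_n.+1) :
  rv_snoc (rv_init mu) (rv_last mu) = mu.
Proof.
apply/rowP => j; rewrite mxE; case: unliftP => [i|] -> //.
by rewrite mxE widen_ord_lift_max.
Qed.

Lemma rv_init_e_last n (mu : 'rV[R]_n.+1) :
  rv_init (e_last R n + mu) = rv_init mu.
Proof.
apply/rowP => i; rewrite !mxE widen_ord_lift_max.
by rewrite [_ == ord_max]eq_sym (negbTE (neq_lift _ _)) andbF add0r.
Qed.

Lemma rv_last_e_last n (mu : 'rV[R]_n.+1) :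
  rv_last (e_last R n + mu) = 1 + rv_last mu.
Proof. by rewrite /rv_last !mxE !eqxx. Qed.

Lemma peval_mwiden n (p : mpoly n R) (mu : 'rV[R]_n.+1) :
  peval (mwiden p) mu = peval p (rv_init mu).
Proof.
rewrite /peval; elim/mpolyind: p => [|c m p _ _ IHp].
  by rewrite mwiden0 !meval0.
rewrite mwidenD mwidenZ !mevalD !mevalZ IHp; congr (_ * _ + _).
rewrite mwidenX !mevalX big_ord_recr /= mnmwiden_ordmax expr0 mulr1.
by apply: eq_bigr => i _; rewrite mnmwiden_widen mxE.
Qed.

Definition q n (mu : 'rV[R]_n) : R := peval (Q R n) mu.

(* The value [1] at [n = 0], a virtual [Q_(-1)], makes the recursions for
   [Q], [Phi] and [D] uniform from [n = 0] on. *)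
Definition qprev n : 'rV[R]_n -> R :=
  match n with 0 => fun=> 1 | m.+1 => fun mu => q (rv_init mu) end.

Lemma q0 (mu : 'rV[R]_0) : q mu = 1.
Proof. by rewrite /q /peval meval1. Qed.

Lemma qS n (mu : 'rV[R]_n.+1) :
  q mu = (2 + rv_last mu) * q (rv_init mu) - qprev (rv_init mu).
Proof.
case: n mu => [|n] mu.
  rewrite q0 /q /peval /= mevalD meval1 mevalXU /rv_last /=; ring.
rewrite {1}/q /= -/(Q R n.+1) /peval mevalB mevalM mevalD mevalMn.
rewrite meval1 mevalXU.
by rewrite -![meval _ _]/(peval _ _) !peval_mwiden.
Qed.

(** Through the recursion, a common zero of two consecutive terms would propagate down to Q_0 =
    1. *)
Lemma q_qprev_neq0 n (x : 'rV[R]_n) : q x = 0 -> qprev x != 0.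
Proof.
elim: n x => [|n IHn] x; first by rewrite q0 => /eqP; rewrite oner_eq0.
rewrite qS /= => qx0; apply/negP => /eqP q0x.
by move: (IHn _ q0x); move/eqP: qx0; rewrite q0x mulr0 sub0r oppr_eq0 => ->.
Qed.

Lemma dom_Phi n (x : 'rV[R]_n) : dom (Phi R n) x <-> q x != 0.
Proof. by case: n x => [|n] x //=; rewrite q0 oner_eq0. Qed.

Lemma pval_Phi n (x : 'rV[R]_n) : pval (Phi R n) x = qprev x / q x - 2.
Proof.
case: n x => [|n] x /=; first by rewrite q0 divr1; ring.
by rewrite peval_mwiden.
Qed.

Lemma q_factor n (mu : 'rV[R]_n.+1) : q (rv_init mu) != 0 ->
  q mu = q (rv_init mu) * (rv_last mu - pval (Phi R n) (rv_init mu)).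
Proof. by move=> qx; rewrite qS pval_Phi; field. Qed.

(** Raising the last coordinate by 1 adds [q (rv_init mu)] to [q mu], which is exactly the term that
    [C] subtracts. *)
Lemma peval_C n (mu : 'rV[R]_n.+1) :
  peval (C R n) (e_last R n + mu) = q mu.
Proof.
rewrite /C /peval mevalB -![meval _ _]/(peval _ _) peval_mwiden.
rewrite -/(q (e_last R n + mu)) -/(q (rv_init _)) !qS rv_init_e_last.
by rewrite rv_last_e_last; ring.
Qed.

(* The number of sign changes in [Q_0, ..., Q_n]; an inner zero is counted once,
   at the step that leaves it. *)
Fixpoint cnt n : 'rV[R]_n -> nat :=
  match n with
  | 0 => fun=> 0%N
  | m.+1 => fun mu =>
      (cnt (rv_init mu) +
       ((q (rv_init mu) * q mu < 0)%R || (q (rv_init mu) == 0)%R))%N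
  end.

Arguments cnt : simpl never.

Lemma cntS n (mu : 'rV[R]_n.+1) : cnt mu =
  (cnt (rv_init mu) +
   ((q (rv_init mu) * q mu < 0)%R || (q (rv_init mu) == 0)%R))%N.
Proof. by []. Qed.

Lemma cnt_le n (mu : 'rV[R]_n) : (cnt mu <= n)%N.
Proof.
elim: n mu => // n IHn mu.
by rewrite cntS; have := IHn (rv_init mu); case: (_ || _); lia.
Qed.

Lemma q_neq0E n (mu : 'rV[R]_n.+1) : q (rv_init mu) != 0 ->
  (q mu != 0) = (rv_last mu != pval (Phi R n) (rv_init mu)).
Proof. by move=> qx; rewrite q_factor // mulf_eq0 (negbTE qx) subr_eq0. Qed.

(** By [q_factor], the product of the last two terms is a positive square times [rv_last mu - Phi],
    so the last step changes sign exactly below the graph. *)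
Lemma cnt_neq0 n (mu : 'rV[R]_n.+1) : q (rv_init mu) != 0 ->
  cnt mu =
    (cnt (rv_init mu) + (rv_last mu < pval (Phi R n) (rv_init mu))%R)%N.
Proof.
move=> qx; rewrite cntS (negbTE qx) orbF q_factor // mulrA -expr2.
by rewrite pmulr_rlt0 ?exprn_even_gt0 // subr_lt0.
Qed.

Lemma q_eq0_init n (x : 'rV[R]_n.+1) : q x = 0 -> q (rv_init x) != 0.
Proof. by move/q_qprev_neq0. Qed.

(** The step into the zero counts nothing, since the product there is 0 and the term before is
    nonzero; the step out of it counts one. *)
Lemma cnt_eq0 n (mu : 'rV[R]_n.+2) : q (rv_init mu) = 0 ->
  cnt mu = (cnt (rv_init (rv_init mu))).+1.
Proof.
move=> qx; rewrite cntS qx eqxx orbT cntS qx mulr0 ltxx addn1.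
by rewrite (negbTE (q_eq0_init qx)) addn0.
Qed.

(** This and the next two lemmas treat the pieces of the inductive definition; their hypothesis is
    the induction hypothesis of [D_cnt]. *)
Lemma epi_D n k (mu : 'rV[R]_n.+1) :
  (forall x, D R n k x <-> q x != 0 /\ cnt x = k) ->
  epi (prestrict (Phi R n) (D R n k)) mu <->
  [/\ q (rv_init mu) != 0, q mu != 0, cnt (rv_init mu) = k & cnt mu = k].
Proof.
move=> Dk; split=> [[[_ /Dk[qx ck]] /= lt]|[qx qmu ck cmu]].
  by split=> //; rewrite ?q_neq0E ?cnt_neq0 // ?gt_eqF // ltNge ltW ?addn0.
split; first by split; [apply/dom_Phi|apply/Dk].
move: qmu cmu; rewrite q_neq0E // cnt_neq0 // ck /=.
by case: ltgtP => //= _ _; lia.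
Qed.

Lemma hypo_D n k (mu : 'rV[R]_n.+1) :
  (forall x, D R n k x <-> q x != 0 /\ cnt x = k) ->
  hypo (prestrict (Phi R n) (D R n k)) mu <->
  [/\ q (rv_init mu) != 0, q mu != 0, cnt (rv_init mu) = k & cnt mu = k.+1].
Proof.
move=> Dk; split=> [[[_ /Dk[qx ck]] /= lt]|[qx qmu ck cmu]].
  by split=> //; rewrite ?q_neq0E ?cnt_neq0 // ?lt_eqF // lt ck addn1.
split; first by split; [apply/dom_Phi|apply/Dk].
by move: cmu; rewrite cnt_neq0 // ck /=; case: ltgtP => //= _; lia.
Qed.

Lemma graph_D n k (mu : 'rV[R]_n.+1) :
  (forall x, D R n k x <-> q x != 0 /\ cnt x = k) ->
  graph (prestrict (Phi R n) (D R n k)) mu <->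
  [/\ q (rv_init mu) != 0, q mu = 0 & cnt (rv_init mu) = k].
Proof.
move=> Dk; split=> [[[_ /Dk[qx ck]] /= e]|[qx qmu ck]].
  by split=> //; apply/eqP; move: (q_neq0E qx); rewrite e eqxx => /negbFE.
split; first by split; [apply/dom_Phi|apply/Dk].
by apply/eqP; rewrite -[_ == _]negbK -q_neq0E // qmu eqxx.
Qed.

Lemma D_step_middle n k : (k < n.+1)%N -> D R n.+2 k.+1 =
  hypo (prestrict (Phi R n.+1) (D R n.+1 k))
  `|` cylinder (graph (prestrict (Phi R n) (D R n k)))
  `|` epi (prestrict (Phi R n.+1) (D R n.+1 k.+1)).
Proof. by move=> kn; rewrite [LHS]/= ltn_eqF // kn. Qed.

(** As [Phi R 0] is the constant -1, the separately defined regions of dimension 1 obey the general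
    rule too. *)
Lemma D_step_last n : D R n.+1 n.+1 = hypo (prestrict (Phi R n) (D R n n)).
Proof.
case: n => [|n]; last by rewrite [LHS]/= eqxx.
by apply/seteqP; split=> x /= => [|[[]]].
Qed.

Lemma D_step_first n : D R n.+1 0 = epi (prestrict (Phi R n) (D R n 0)).
Proof. by case: n => [|//]; apply/seteqP; split=> x /= => [|[[]]]. Qed.

Lemma D_gt n k : (n < k)%N -> D R n k = set0.
Proof.
case: n k => [|[|n]] [|k] //; first by case: k.
by rewrite ltnS => nk; rewrite /= gtn_eqF // ltnNge ltnW.
Qed.

Lemma D_cnt n k (mu : 'rV[R]_n) : D R n k mu <-> q mu != 0 /\ cnt mu = k.
Proof.
(* The cylinder piece refers two dimensions back, so the induction carries two consecutive
   dimensions. *)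
suff: (forall k (mu : 'rV[R]_n), D R n k mu <-> q mu != 0 /\ cnt mu = k) /\
  (forall k (mu : 'rV[R]_n.+1), D R n.+1 k mu <-> q mu != 0 /\ cnt mu = k).
  by case.
have init m : (forall k (x : 'rV[R]_m), D R m k x <-> q x != 0 /\ cnt x = k) ->
  forall mu : 'rV[R]_m.+1, D R m.+1 0 mu <-> q mu != 0 /\ cnt mu = 0%N.
  move=> Dm {}mu; rewrite D_step_first epi_D //.
  split=> [[]//|[qmu c0]]; move: (c0); rewrite cntS => /eqP.
  by rewrite addn_eq0 eqb0 negb_or => /andP[/eqP ? /andP[_ ?]].
have last m : (forall k (x : 'rV[R]_m), D R m k x <-> q x != 0 /\ cnt x = k) ->
  forall mu : 'rV[R]_m.+1, D R m.+1 m.+1 mu <-> q mu != 0 /\ cnt mu = m.+1.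
  move=> Dm {}mu; rewrite D_step_last hypo_D //.
  split=> [[]//|[qmu c0]].
  (* The maximal count leaves no room for an inner zero at the end: it would use two steps for a
     single sign change. *)
  have := cnt_le (rv_init mu).
  have [qx|qx] := eqVneq (q (rv_init mu)) 0; last first.
    by move: c0; rewrite cntS; case: (_ || _) => //= *; split=> //; lia.
  case: m {Dm} mu c0 qx qmu => [|m] mu c0 qx qmu.
    by move: qx => /eqP; rewrite q0 oner_eq0.
  by have := cnt_le (rv_init (rv_init mu)); move: c0; rewrite cnt_eq0 //; lia.
have gt m j (x : 'rV[R]_m) : (m < j)%N -> D R m j x <-> q x != 0 /\ cnt x = j.
  move=> mj; rewrite D_gt //; split=> // -[_ cj].
  by have := cnt_le x; lia.
elim: n {k mu} => [|n [IH1 IH2]]; last split=> //.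
  have H0 k (mu : 'rV[R]_0) : D R 0 k mu <-> q mu != 0 /\ cnt mu = k.
    by case: k => [|k] /=; rewrite q0 oner_eq0; split=> // -[].
  by split=> // -[|[|k]] mu; [exact: init|exact: last|exact: gt].
case=> [|k] mu; first exact: init.
have [kn|nk|->] := ltngtP k n.+1; [|exact: gt|exact: last].
rewrite D_step_middle //.
have IHh := @hypo_D n.+1 k mu (IH2 k); have IHe := @epi_D n.+1 k.+1 mu (IH2 _).
have IHg := @graph_D n k (rv_init mu) (IH1 k).
split=> [[[/IHh[]|/IHg[qx qx0 ck]]|/IHe[]]|[qmu cmu]] //.
  rewrite cnt_eq0 // ck qS qx0 mulr0 sub0r oppr_eq0; split=> //.
(* A zero of the last but one term gives the cylinder; otherwise the last step changes sign on the
   hypograph and not on the epigraph. *)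
have [qx|qx] := eqVneq (q (rv_init mu)) 0.
  left; right; apply/IHg; split=> //; first exact: q_eq0_init.
  by move: cmu; rewrite cnt_eq0 // => -[].
move: (cmu); rewrite cntS; case: (_ || _).
  by rewrite addn1 => -[ck]; left; left; apply/IHh.
by rewrite addn0 => ck; right; apply/IHe.
Qed.

End SignChanges.

(** * Continuity and smoothness of polynomial functions *)

Section PolynomialSmoothness.
Variables (R : realType) (n : nat).

(** Monomials are unfolded into products of variables, so that the sum and product rules suffice for
    continuity and derivatives. *)
Lemma mpoly_ring_ind (P : mpoly n R -> Prop) :
  (forall c, P (mpolyC n c)) -> (forall i, P (mpolyX R (mnm1 i))) ->
  (forall p r, P p -> P r -> P (p + r)) ->
  (forall p r, P p -> P r -> P (p * r)) -> forall p, P p.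
Proof.
move=> PC PX PD PM p.
elim/mpolyind: p => [|c m p _ _ IHp]; first by rewrite -mpolyC0; exact: PC.
apply: (PD) => //; rewrite -mul_mpolyC; apply: (PM) => //.
rewrite mpolyXE_id; elim/big_ind: _ => // [|i _].
  by rewrite -mpolyC1; exact: PC.
elim: (m i) => [|k IHk]; first by rewrite expr0 -mpolyC1; exact: PC.
by rewrite exprS; exact: PM.
Qed.

Lemma continuous_peval (p : mpoly n R) : continuous (peval p).
Proof.
elim/mpoly_ring_ind: p => [c|i|p r IHp IHr|p r IHp IHr] mu.
- rewrite (_ : peval _ = cst c); first exact: cst_continuous.
  by apply/funext => x; rewrite /peval mevalC.
- rewrite (_ : peval _ = fun x : 'rV[R]_n => x 0 i).
    exact: coord_continuous.
  by apply/funext => x; rewrite /peval mevalXU.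
- rewrite (_ : peval _ = peval p \+ peval r).
    exact: (continuousD (IHp mu) (IHr mu)).
  by apply/funext => x; rewrite /peval mevalD.
- rewrite (_ : peval _ = peval p \* peval r).
    exact: (continuousM (IHp mu) (IHr mu)).
  by apply/funext => x; rewrite /peval mevalM.
Qed.

Lemma is_derive_affine (f : 'rV[R]_n -> R) x v a :
  (forall h, f (h *: v + x) = f x + h * a) -> is_derive x v f a.
Proof.
move=> fE.
have fa : h^-1 *: ((f \o shift x) (h *: v) - f x) @[h --> 0^'] --> a.
  apply: cvg_near_cst; near=> h.
  rewrite /= fE addrAC subrr add0r; apply: mulKf.
  by near: h; exact: nbhs_dnbhs_neq.
by apply: DeriveDef; [apply/cvg_ex; exists a|exact/cvg_lim].
Unshelve. all: by end_near. Qed.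

Lemma is_derive_peval (p : mpoly n R) (i : 'I_n) (x : 'rV[R]_n) :
  is_derive x (delta_mx 0 i) (peval p) (peval (mderiv i p) x).
Proof.
elim/mpoly_ring_ind: p => [c|j|p r IHp IHr|p r IHp IHr].
- apply: is_derive_affine => h.
  by rewrite mderivC /peval meval0 !mevalC mulr0 addr0.
- apply: is_derive_affine => h.
  rewrite mderivX mnm1E /peval mevalZ !mevalXU !mxE eqxx /= addrC.
  case: eqVneq => [->|_]; last by rewrite !mul0r !mulr0.
  have -> : mnm_sub (mnm1 i) (mnm1 i) = mnm0.
    by apply/mnmP => k; rewrite mnmBE mnm0E subnn.
  by rewrite mpolyX0 meval1 !mulr1.
- rewrite (_ : peval (p + r) = peval p + peval r).
    by rewrite mderivD {3}/peval mevalD; exact: is_deriveD.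
  by apply/funext => y; rewrite /peval mevalD.
- rewrite (_ : peval (p * r) = peval p * peval r).
    rewrite mderivM {3}/peval mevalD !mevalM addrC [X in _ + X]mulrC.
    exact: is_deriveM.
  by apply/funext => y; rewrite /peval mevalM.
Qed.

(** Partial derivatives of polynomials are again polynomials, so induction on the order works with
    [p] generalized. *)
Lemma smooth_on_peval (U : set 'rV[R]_n) (p : mpoly n R) :
  smooth_on U (peval p).
Proof.
have cp (r : mpoly n R) : {in U, continuous (peval r)}.
  by move=> x _; exact: continuous_peval.
move=> r; elim: r p => [|r IHr] p; split=> //= i; split=> [x _|].
  by have [] := is_derive_peval p i x.
rewrite (_ : (fun x => _) = peval (mderiv i p)); first exact: IHr.
by apply/funext => x; have [] := is_derive_peval p i x.
Qed.

End PolynomialSmoothness.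

(** * Paths and connectedness *)

Section Paths.
Variables (R : realType) (n : nat).
Implicit Types (A : set 'rV[R]_n) (x y z : 'rV[R]_n).

Lemma continuous_rV (T : topologicalType) (f : T -> 'rV[R]_n) (t : T) :
  (forall j, {for t, continuous (fun s => f s 0 j)}) -> {for t, continuous f}.
Proof.
move=> cf A [B nB BA].
have : \forall s \near t, forall j, B 0 j (f s 0 j).
  by apply: filter_forall => j; exact: cf.
by apply: filterS => s Bs; apply: BA => i j; rewrite ord1; exact: Bs.
Qed.

Lemma continuousT_comp (S T U : topologicalType) (f : S -> T) (g : T -> U) :
  continuous f -> continuous g -> continuous (fun s => g (f s)).
Proof. by move=> cf cg s; exact: (continuous_comp (cf s) (cg _)). Qed.

Definition clamp (t : R) : R := Num.max 0 (Num.min 1 t).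

Lemma clamp_continuous : continuous clamp.
Proof.
move=> t; apply: (@continuous_max R R (cst 0) (fun t => Num.min 1 t)).
  exact: cst_continuous.
by apply: (@continuous_min R R (cst 1) id) => //; exact: cst_continuous.
Qed.

Lemma clamp_le0 t : t <= 0 -> clamp t = 0.
Proof. by rewrite /clamp; case: (lerP 1 t) => ?; case: lerP; lra. Qed.

Lemma clamp_ge1 t : 1 <= t -> clamp t = 1.
Proof. by rewrite /clamp; case: (lerP 1 t) => ?; case: lerP; lra. Qed.

Lemma clamp_itv t : 0 <= clamp t <= 1.
Proof. by rewrite /clamp le_max lexx ge_max ler01 ge_min lexx. Qed.

(* Total paths, rather than paths on [[0, 1]], so that continuity need not be
   relativized; [clamp] turns the latter into the former. *)
Definition joined A x y := exists g : R -> 'rV[R]_n,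
  [/\ continuous g, g 0 = x, g 1 = y & forall t, A (g t)].

Lemma joined_refl A x : A x -> joined A x x.
Proof. by exists (cst x); split=> // t; exact: cst_continuous. Qed.

Lemma joined_sym A x y : joined A x y -> joined A y x.
Proof.
move=> [g [gc g0 g1 gA]]; exists (fun t => g (1 - t)).
split=> [|||t]; [|by rewrite subr0|by rewrite subrr|exact: gA].
apply: (@continuousT_comp R R _ (fun t => 1 - t)) => // t.
by apply: cvgB; [exact: cvg_cst|exact: cvg_id].
Qed.

(* Outside the half of the unit interval that it traverses, each of the two
   paths is constantly equal to one of its ends. *)
Lemma joined_trans A x y z : joined A x y -> joined A y z -> joined A x z.
Proof.
move=> [g [gc g0 g1 gA]] [h [hc h0 h1 hA]].
exists (fun t => g (clamp (2 * t)) + h (clamp (2 * t - 1)) - y).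
split=> [|||t].
- have c2 : continuous (fun t : R => 2 * t).
    by move=> t; apply: cvgM; [exact: cvg_cst|exact: cvg_id].
  have c21 : continuous (fun t : R => 2 * t - 1).
    by move=> t; apply: cvgB; [exact: c2|exact: cvg_cst].
  have cg := continuousT_comp (continuousT_comp c2 clamp_continuous) gc.
  have ch := continuousT_comp (continuousT_comp c21 clamp_continuous) hc.
  move=> t; apply: cvgB; last exact: cvg_cst.
  by apply: cvgD; [exact: cg|exact: ch].
- by rewrite !clamp_le0 ?g0 ?h0 ?addrK //; lra.
- by rewrite !clamp_ge1 ?g1 ?h1 ?[y + _]addrC ?addrK //; lra.
- have [t2|t2] := lerP (2 * t) 1.
    by rewrite [X in h X]clamp_le0 ?h0 ?addrK //; lra.
  by rewrite [X in g X]clamp_ge1 ?g1 1?[y + _]addrC ?addrK //; lra.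
Qed.

Lemma joined_path_connected A :
  (forall x y, A x -> A y -> joined A x y) -> path_connected R A.
Proof.
move=> cA x y Ax Ay; have [g [gc g0 g1 gA]] := cA _ _ Ax Ay.
by exists g; split=> //; exact: continuous_subspaceT.
Qed.

(** A nonempty [A] is a union of connected subsets through one fixed point, namely images of
    paths. *)
Lemma path_connected_connected A : path_connected R A -> connected A.
Proof.
move=> cA; have [->|/set0P[x Ax]] := eqVneq A set0; first exact: connected0.
have -> : A = \bigcup_(B in [set B | [/\ connected B, B `<=` A & B x]]) B.
  apply/seteqP; split=> [y Ay|y [B [_ BA _]] /BA//].
  have [g [gc g0 g1 gA]] := cA _ _ Ax Ay.
  exists (g @` `[0, 1]); last by exists 1 => //=; rewrite in_itv /= ler01 lexx.
  split; last by exists 0 => //=; rewrite in_itv /= ler01 lexx.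
    by apply: connected_continuous_connected => //; exact: segment_connected.
  by move=> _ [t t01 <-]; apply: gA.
by apply: bigcup_connected => [|B []//]; exists x => B [].
Qed.

Lemma open_segment A x v : open A -> A x ->
  exists2 e, 0 < e & forall s, `|s| <= e -> joined A x (x + s *: v).
Proof.
move=> oA Ax.
have lc : continuous (fun s : R => x + s *: v).
  by move=> s; apply: cvgD; [exact: cvg_cst|apply: cvgZl; exact: cvg_id].
have /nbhs_ballP[e /= e0 eA] : \forall s \near (0 : R), A (x + s *: v).
  by apply: lc; apply: open_nbhs_nbhs; rewrite scale0r addr0.
(* Halving the radius allows the non-strict bound on [s] while staying in the open ball. *)
exists (e / 2); first by rewrite divr_gt0.
move=> s se; exists (fun t => x + (clamp t * s) *: v); split=> [|||t].
- apply: (continuousT_comp _ lc) => t.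
  by apply: cvgM; [exact: clamp_continuous|exact: cvg_cst].
- by rewrite clamp_le0 // mul0r scale0r addr0.
- by rewrite clamp_ge1 // mul1r.
- apply: eA; rewrite /ball /= sub0r normrN normrM.
  have /andP[c0 c1] := clamp_itv t; rewrite (ger0_norm c0).
  have := normr_ge0 s; nra.
Qed.

End Paths.

(** * Local constancy of the sign count and openness of the regions *)

Section Regions.
Variable R : realType.

Lemma rv_init_continuous n : continuous (@rv_init R n).
Proof.
move=> mu; apply: continuous_rV => j.
rewrite (_ : (fun s => _) =
  fun s : 'rV[R]_n.+1 => s 0 (widen_ord (leqnSn n) j)).
  exact: coord_continuous.
by apply/funext => s; rewrite mxE.
Qed.

Lemma rv_snoc_continuous n (T : topologicalType) (f : T -> 'rV[R]_n)
    (g : T -> R) : continuous f -> continuous g ->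
  continuous (fun t => rv_snoc (f t) (g t)).
Proof.
move=> cf cg t; apply: continuous_rV => j; case: (unliftP ord_max j) => [i|] ->.
  rewrite (_ : (fun s => _) = fun s => f s 0 i).
    exact: (continuousT_comp cf (@coord_continuous R 1 n 0 i)).
  by apply/funext => s; rewrite mxE liftK.
rewrite (_ : (fun s => _) = g); first exact: cg.
by apply/funext => s; rewrite mxE unlift_none.
Qed.

Lemma q_continuous n : continuous (@q R n).
Proof. exact: continuous_peval. Qed.

Lemma qprev_continuous n : continuous (@qprev R n).
Proof.
case: n => [|n]; first by move=> x; exact: cst_continuous.
exact: (continuousT_comp (@rv_init_continuous n) (@q_continuous n)).
Qed.

Lemma q_neq0_near n (mu : 'rV[R]_n) :
  q mu != 0 -> \forall nu \near mu, q nu != 0.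
Proof. exact: (cvgr_neq0 (q mu) (@q_continuous n mu)). Qed.

Lemma mul_lt0_near (T : topologicalType) (f g : T -> R) (x : T) :
  continuous f -> continuous g -> f x * g x != 0 ->
  \forall y \near x, (f y * g y < 0) = (f x * g x < 0).
Proof.
move=> cf cg; have cfg : f y * g y @[y --> x] --> f x * g x.
  by apply: cvgM; [exact: cf|exact: cg].
case: ltgtP => // fg0 _.
  by near=> y; near: y; exact: (cvgr_lt _ cfg _ fg0).
near=> y; apply/negbTE; rewrite -leNgt ltW //; near: y.
exact: (cvgr_gt _ cfg _ fg0).
Unshelve. all: by end_near. Qed.

(** The middle number shares its sign with exactly one of the outer two; this is how a perturbed
    inner zero still counts once. *)
Lemma opposite_signs (a b c : R) : a * c < 0 -> b != 0 ->
  ((a * b < 0)%R + (b * c < 0)%R)%N = 1%N.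
Proof.
move=> ac b0.
suff : (a * b < 0) != (b * c < 0) by do 2!case: (_ < 0).
have b2 : 0 < b ^+ 2 by rewrite exprn_even_gt0.
have [ab|ab] := ltrP (a * b) 0; have [bc|bc] := ltrP (b * c) 0 => //; nra.
Qed.

Lemma cnt_near n (mu : 'rV[R]_n) : q mu != 0 ->
  \forall nu \near mu, cnt nu = cnt mu.
Proof.
suff: (forall mu : 'rV[R]_n, q mu != 0 -> \forall nu \near mu, cnt nu = cnt mu)
  /\ (forall mu : 'rV[R]_n.+1, q mu != 0 ->
        \forall nu \near mu, cnt nu = cnt mu) by case=> + _; exact.
have regular m : (forall mu : 'rV[R]_m, q mu != 0 ->
    \forall nu \near mu, cnt nu = cnt mu) ->
  forall mu : 'rV[R]_m.+1, q (rv_init mu) != 0 -> q mu != 0 ->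
    \forall nu \near mu, cnt nu = cnt mu.
  move=> IH {}mu qx qmu.
  have cqi : continuous (fun nu : 'rV[R]_m.+1 => q (rv_init nu)).
    exact: (continuousT_comp (@rv_init_continuous m) (@q_continuous m)).
  near=> nu; rewrite !cntS (negbTE qx).
  have /negbTE -> : q (rv_init nu) != 0.
    by near: nu; exact: (@rv_init_continuous _ mu _ (q_neq0_near qx)).
  have -> : cnt (rv_init nu) = cnt (rv_init mu).
    by near: nu; exact: (@rv_init_continuous _ mu _ (IH _ qx)).
  congr (_ + (_ || _))%N; near: nu.
  by apply: (mul_lt0_near cqi (@q_continuous _)); rewrite mulf_neq0.
elim: n {mu} => [|n [IH1 IH2]].
  have H0 (mu : 'rV[R]_0) : q mu != 0 -> \forall nu \near mu, cnt nu = cnt mu.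
    by move=> _; near=> nu.
  by split=> // mu; apply: regular; rewrite ?q0 ?oner_neq0.
split=> // mu qmu.
have [qx|qx] := eqVneq (q (rv_init mu)) 0; last exact: regular.
have qz := q_eq0_init qx.
have ci2 : continuous (fun nu : 'rV[R]_n.+2 => rv_init (rv_init nu)).
  exact: continuousT_comp (@rv_init_continuous n.+1) (@rv_init_continuous n).
have cqi2 := continuousT_comp ci2 (@q_continuous n).
(* When the middle term vanishes, the recursion makes the last term the negative of the one before
   the zero. *)
have qq0 : q (rv_init (rv_init mu)) * q mu < 0.
  rewrite [q mu]qS qx mulr0 sub0r mulrN oppr_lt0 -expr2.
  by rewrite exprn_even_gt0.
near=> nu; rewrite [RHS]cnt_eq0 //.
have cz : cnt (rv_init (rv_init nu)) = cnt (rv_init (rv_init mu)).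
  by near: nu; exact: (ci2 mu _ (IH1 _ qz)).
have qz' : q (rv_init (rv_init nu)) != 0.
  by near: nu; exact: (ci2 mu _ (q_neq0_near qz)).
have qq : q (rv_init (rv_init nu)) * q nu < 0.
  suff -> : (q (rv_init (rv_init nu)) * q nu < 0) =
      (q (rv_init (rv_init mu)) * q mu < 0) by [].
  near: nu; apply: (mul_lt0_near cqi2 (@q_continuous _)).
  by rewrite lt_eqF.
(* At a nearby point the middle term may vanish or take either sign; the last two steps contribute
   one in each case. *)
have [qx'|qx'] := eqVneq (q (rv_init nu)) 0; first by rewrite cnt_eq0 // cz.
rewrite !cntS (negbTE qz') (negbTE qx') !orbF cz -addnA opposite_signs //.
by rewrite addn1.
Unshelve. all: by end_near. Qed.

Lemma open_D n k : open (D R n k).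
Proof.
rewrite openE => mu /D_cnt[qmu cmu]; rewrite /interior.
near=> nu; apply/D_cnt; split; first by near: nu; exact: q_neq0_near.
by rewrite -cmu; near: nu; exact: cnt_near.
Unshelve. all: by end_near. Qed.

(** * Path-connectedness of the regions *)

Lemma D_snoc n k (x : 'rV[R]_n) (d : R) : D R n k x -> d != 0 ->
  D R n.+1 (k + (d < 0)%R) (rv_snoc x (pval (Phi R n) x + d)).
Proof.
move=> /D_cnt[qx <-] d0; apply/D_cnt.
rewrite q_neq0E ?cnt_neq0 ?rv_init_snoc // rv_last_snoc gtrDl; split=> //.
by rewrite -subr_eq0 addrAC subrr add0r.
Qed.

Lemma D_nonempty n k : (k <= n)%N -> D R n k !=set0.
Proof.
elim: n k => [|n IHn] [|k] //= kn; first by exists 0.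
  have [x Dx] := IHn 0%N isT; have := D_snoc Dx (oner_neq0 R).
  by rewrite ltr10; eexists; eassumption.
have [x Dx] := IHn k kn.
have N1 : -1 != 0 :> R by rewrite oppr_eq0 oner_neq0.
have := D_snoc Dx N1.
by rewrite ltrN10 addn1; eexists; eassumption.
Qed.

(** Over a path in the base, the last coordinate follows [Phi] plus an offset; both ends lie on the
    same side of the graph, so the offset can be interpolated without vanishing. *)
Lemma joined_D_fibre n j k (mu nu : 'rV[R]_n.+1) :
  (forall x y, D R n j x -> D R n j y -> joined (D R n j) x y) ->
  D R n.+1 k mu -> D R n.+1 k nu ->
  D R n j (rv_init mu) -> D R n j (rv_init nu) ->
  joined (D R n.+1 k) mu nu.
Proof.
move=> IH /D_cnt[qmu cmu] /D_cnt[qnu cnu] Dx Dy.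
have [h [hc h0 h1 hD]] := IH _ _ Dx Dy.
have [/D_cnt[qx cx] /D_cnt[qy cy]] := (Dx, Dy).
have qh t : q (h t) != 0 by have /D_cnt[] := hD t.
have ch t : cnt (h t) = j by have /D_cnt[] := hD t.
pose a := rv_last mu - pval (Phi R n) (rv_init mu).
pose b := rv_last nu - pval (Phi R n) (rv_init nu).
have a0 : a != 0 by rewrite subr_eq0 -q_neq0E.
have b0 : b != 0 by rewrite subr_eq0 -q_neq0E.
(* Equal counts over bases of equal count force the two offsets to have the same sign. *)
have ab : (a < 0) = (b < 0).
  rewrite !subr_lt0; move: cmu cnu; rewrite !cnt_neq0 // cx cy => <- /addnI.
  by do 2!case: (_ < _).
have kE : (j + (a < 0)%R)%N = k by rewrite subr_lt0 -cmu cnt_neq0 // cx.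
have Phic : continuous (fun t => pval (Phi R n) (h t)).
  rewrite (_ : (fun t => _) = fun t => qprev (h t) / q (h t) - 2).
    move=> t; apply: cvgB; last exact: cvg_cst.
    apply: cvgM; first exact: (continuousT_comp hc (@qprev_continuous n)).
    by apply: cvgV => //; exact: (continuousT_comp hc (@q_continuous n)).
  by apply/funext => t; rewrite pval_Phi.
pose d t := (1 - clamp t) * a + clamp t * b.
have dc : continuous d.
  move=> t; apply: cvgD; (apply: cvgM; last exact: cvg_cst).
    by apply: cvgB; [exact: cvg_cst|exact: clamp_continuous].
  exact: clamp_continuous.
have dP t : d t != 0 /\ (d t < 0) = (a < 0).
  rewrite /d; have /andP[c0 c1] := clamp_itv t.
  case: ltgtP ab a0 => // a0 /esym; case: ltgtP b0 => // b0 _ _ _.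
    suff d0 : (1 - clamp t) * a + clamp t * b < 0 by rewrite d0 lt_eqF.
    nra.
  suff d0 : 0 < (1 - clamp t) * a + clamp t * b by rewrite gt_eqF // ltNge ltW.
  nra.
exists (fun t => rv_snoc (h t) (pval (Phi R n) (h t) + d t)); split=> [|||t].
- apply: rv_snoc_continuous => // t.
  by apply: cvgD; [exact: Phic|exact: dc].
- rewrite /d h0 clamp_le0 // mul0r subr0 mul1r addr0 /a addrC subrK.
  exact: rv_snoc_eta.
- rewrite /d h1 clamp_ge1 // subrr mul0r mul1r add0r /b addrC subrK.
  exact: rv_snoc_eta.
- by have [d0 dE] := dP t; rewrite -kE -dE; exact: D_snoc.
Qed.

Lemma rv_init_add_e_last n (mu : 'rV[R]_n.+1) s :
  rv_init (mu + s *: e_last R n) = rv_init mu.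
Proof.
apply/rowP => i; rewrite !mxE widen_ord_lift_max.
by rewrite [_ == ord_max]eq_sym (negbTE (neq_lift _ _)) andbF mulr0 addr0.
Qed.

Lemma q_add_e_last n (mu : 'rV[R]_n.+1) s :
  q (mu + s *: e_last R n) = q mu + s * q (rv_init mu).
Proof.
by rewrite !qS rv_init_add_e_last /rv_last !mxE !eqxx /=; ring.
Qed.

(** This is the gluing: the segment leads into the hypograph part for [j = k] and into the epigraph
    part for [j = k.+1]. *)
Lemma joined_D_bridge n k j (mu : 'rV[R]_n.+2) : D R n.+2 k.+1 mu ->
  q (rv_init mu) = 0 -> j = k \/ j = k.+1 ->
  exists nu, joined (D R n.+2 k.+1) mu nu /\ D R n.+1 j (rv_init nu).
Proof.
move=> Dmu qx jk; have /D_cnt[qmu cmu] := Dmu.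
(* Moving the last but one coordinate by [s] turns the vanishing term into [s] times the term before
   it, so the sign of [s] decides whether that step changes sign. *)
pose v : 'rV[R]_n.+2 := rv_snoc (e_last R n) 0.
have [e e0 eD] := open_segment v (@open_D n.+2 k.+1) Dmu.
pose s := if j == k then e else - e.
have se : `|s| <= e by rewrite /s; case: ifP => _; rewrite ?normrN gtr0_norm.
have s0 : s != 0 by rewrite /s; case: ifP => _; rewrite ?oppr_eq0 gt_eqF.
exists (mu + s *: v); split; first exact: eD.
have -> : rv_init (mu + s *: v) = rv_init mu + s *: e_last R n.
  rewrite -[e_last R n](rv_init_snoc _ 0) -/v.
  by apply/rowP => i; rewrite !mxE.
have qz := q_eq0_init qx.
apply/D_cnt; rewrite q_add_e_last qx add0r mulf_neq0 //; split=> //.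
rewrite cntS q_add_e_last qx add0r rv_init_add_e_last (negbTE qz).
rewrite orbF mulrCA -expr2.
rewrite pmulr_llt0 ?exprn_even_gt0 //.
move: cmu; rewrite cnt_eq0 // => -[->]; rewrite /s.
case: jk => ->; rewrite ?eqxx ?gtn_eqF // ?oppr_lt0.
  by rewrite ltNge ltW // addn0.
by rewrite e0 addn1.
Qed.

Lemma D_snoc_bridge n k (x : 'rV[R]_n) y : D R n k x ->
  D R n.+2 k.+1 (rv_snoc (rv_snoc x (pval (Phi R n) x)) y) /\
  q (rv_snoc x (pval (Phi R n) x)) = 0.
Proof.
move=> /D_cnt[qx cx].
have q0' : q (rv_snoc x (pval (Phi R n) x)) = 0.
  by rewrite q_factor rv_init_snoc // rv_last_snoc subrr mulr0.
split=> //; apply/D_cnt; rewrite qS cnt_eq0 !rv_init_snoc // cx.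
by rewrite q0' mulr0 sub0r oppr_eq0; split=> //; exact: q_qprev_neq0.
Qed.

(** For [k = 0] the region is a single epigraph and [joined_D_fibre] suffices; otherwise all points
    are first brought into the hypograph. *)
Lemma joined_D n k (mu nu : 'rV[R]_n) :
  D R n k mu -> D R n k nu -> joined (D R n k) mu nu.
Proof.
elim: n k mu nu => [|n IHn] k mu nu.
  move=> Dmu _; have -> : nu = mu by apply/rowP => -[].
  exact: joined_refl.
case: k mu nu => [mu nu Dmu Dnu|k].
  apply: (@joined_D_fibre n 0) => //; first exact: IHn.
    move: Dmu => /D_cnt[qmu /eqP]; rewrite cntS addn_eq0 eqb0 negb_or.
    by move=> /andP[/eqP c0 /andP[_ ?]]; apply/D_cnt.
  move: Dnu => /D_cnt[qnu /eqP]; rewrite cntS addn_eq0 eqb0 negb_or.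
  by move=> /andP[/eqP c0 /andP[_ ?]]; apply/D_cnt.
(* Every point is joined to one lying under the graph of [Phi]. *)
have below x : D R n.+1 k.+1 x ->
    exists y, joined (D R n.+1 k.+1) x y /\ D R n k (rv_init y).
  move=> Dx; have /D_cnt[qx cx] := Dx.
  have [qi|qi] := eqVneq (q (rv_init x)) 0.
    case: n IHn x Dx qx cx qi => [|n] IHn x Dx qx cx qi.
      by move: qi => /eqP; rewrite q0 oner_eq0.
    exact: joined_D_bridge Dx qi (or_introl erefl).
  move: cx; rewrite cntS; case: (_ || _).
    rewrite addn1 => -[ck]; exists x; split; first exact: joined_refl.
    exact/D_cnt.
  rewrite addn0 => ck; have kn := cnt_le (rv_init x).
  case: n IHn x Dx qx ck kn qi => [|n] IHn x Dx qx ck kn qi; first by lia.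
  (* Here [x] lies in the epigraph part. A gluing point [rv_snoc x0 0] is built over a point of the
     graph of [Phi], with arbitrary height 0; it is left towards [y] in the hypograph and [y'] in
     the epigraph. *)
  have [z Dz] : D R n k !=set0 by apply: D_nonempty; lia.
  have [Db qb] := D_snoc_bridge 0 Dz; move: qb.
  set x0 := rv_snoc z _ in Db * => qb.
  have qi0 : q (rv_init (rv_snoc x0 0)) = 0 by rewrite rv_init_snoc.
  have [y [jy Dy]] := joined_D_bridge Db qi0 (or_introl erefl).
  have [y' [jy' Dy']] := joined_D_bridge Db qi0 (or_intror erefl).
  exists y; split=> //; apply: joined_trans jy; apply: joined_sym.
  apply: (joined_trans jy'); apply: (@joined_D_fibre n.+1 k.+1) => //.
  - exact: IHn.
  - by case: jy' => g [_ _ <- gD].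
  - exact/D_cnt.
move=> mu nu /below[x [jx Dx]] /below[y [jy Dy]].
apply: (joined_trans jx); apply: (joined_trans _ (joined_sym jy)).
apply: (@joined_D_fibre n k) => //; first exact: IHn.
- by case: jx => g [_ _ <- gD].
- by case: jy => g [_ _ <- gD].
Qed.

End Regions.

(** * Transport to the variety of C and its complement *)

Section JostVariety.
Variables (R : realType) (n : nat).

Lemma coord_le_norm m (x : 'rV[R]_m) i : `|x 0 i| <= `|x|.
Proof.
by rewrite -[`|x|]/(mx_norm x) mx_normrE (le_bigmax _ _ (0, i)).
Qed.

Lemma q_translate (mu : 'rV[R]_n.+1) : q (mu - e_last R n) = peval (C R n) mu.
Proof. by rewrite -peval_C addrC subrK. Qed.

Lemma rv_init_translate (mu : 'rV[R]_n.+1) :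
  rv_init (mu - e_last R n) = rv_init mu.
Proof. by rewrite -rv_init_e_last addrC subrK. Qed.

Lemma rv_last_translate (mu : 'rV[R]_n.+1) :
  rv_last (mu - e_last R n) = rv_last mu - 1.
Proof.
by apply/eqP; rewrite eq_sym subr_eq addrC -rv_last_e_last addrC subrK.
Qed.

Lemma translateE (A : set 'rV[R]_n.+1) :
  [set e_last R n + mu | mu in A] = [set mu | A (mu - e_last R n)].
Proof.
apply/seteqP; split=> [_ [mu Amu <-]|mu Amu] /=; first by rewrite addrC addKr.
by exists (mu - e_last R n) => //; rewrite addrC subrK.
Qed.

Lemma G_E k : G R n k = [set mu | D R n.+1 k (mu - e_last R n)].
Proof. exact: translateE. Qed.

Lemma V_C : V (C R n) = [set mu | q (mu - e_last R n) = 0].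
Proof. by apply/seteqP; split=> mu; rewrite /V /= q_translate. Qed.

(** [Phi + 1] is the unique root of [C] in its last variable; the polynomial equation later serves
    as the local defining function. *)
Lemma graph_C k :
  graph (prestrict (paddc (Phi R n) 1) (D R n k)) =
  [set mu | D R n k (rv_init mu) /\ peval (C R n) mu = 0].
Proof.
apply/seteqP; split=> mu /=.
  move=> [[_ Dmu] /= lmu]; split=> //; have /D_cnt[qmu _] := Dmu.
  rewrite -q_translate q_factor rv_init_translate // rv_last_translate lmu.
  by rewrite addrK subrr mulr0.
move=> [Dmu]; have /D_cnt[qmu _] := Dmu.
rewrite -q_translate q_factor rv_init_translate // rv_last_translate => /eqP.
rewrite mulf_eq0 (negbTE qmu) /= subr_eq0 subr_eq => /eqP lmu.
by split=> //; split=> //; exact/dom_Phi.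
Qed.

(** [C] is affine in its last variable; the slope is nonzero over every D_k^(n), which gives the
    nonvanishing gradient. *)
Lemma is_derive_C (mu : 'rV[R]_n.+1) :
  is_derive mu (delta_mx 0 ord_max) (peval (C R n)) (q (rv_init mu)).
Proof.
apply: is_derive_affine => h; rewrite -!q_translate -addrA addrC -/(e_last R n).
by rewrite q_add_e_last rv_init_translate.
Qed.

Lemma smooth_hypersurface_graph k : (k <= n)%N ->
  smooth_hypersurface (graph (prestrict (paddc (Phi R n) 1) (D R n k))).
Proof.
move=> kn; split.
  have [x Dx] := D_nonempty R kn.
  exists (rv_snoc x (pval (Phi R n) x + 1)).
  have /D_cnt[qx _] := Dx.
  by split; rewrite ?rv_init_snoc ?rv_last_snoc //; split=> //; exact/dom_Phi.
rewrite graph_C => p [Dp _].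
exists (@rv_init R n @^-1` D R n k), (peval (C R n)); split.
- by apply: open_comp; [move=> x _; exact: rv_init_continuous|exact: open_D].
- by [].
- exact: smooth_on_peval.
- by apply/seteqP; split=> x /= [] => [[]|].
- move=> x [Dx _] _; exists ord_max; have [_ ->] := is_derive_C x.
  by have /D_cnt[] := Dx.
Qed.

Lemma far_shift (c M : R) (neg : bool) :
  exists d, [/\ d != 0, (d < 0) = neg & M < `|c + d|].
Proof.
pose b := `|c| + `|M| + 1.
have b0 : 0 < b by rewrite ltr_wpDl ?addr_ge0.
have bM : M + `|c| < b by rewrite /b; have := ler_norm M; lra.
exists ((-1) ^+ neg * b); split.
- by rewrite mulf_neq0 ?signr_eq0 ?gt_eqF.
- by rewrite pmulr_llt0 // signr_lt0.
have := ler_normB (c + (-1) ^+ neg * b) c.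
by rewrite addrAC subrr add0r normrMsign gtr0_norm //; lra.
Qed.

Lemma unbounded_G k : (k <= n.+1)%N -> ~ bounded_set (G R n k).
Proof.
move=> kn [M [_ /(_ (M + 1))]]; rewrite ltrDl ltr01 => /(_ isT) GM.
(* The region contains a vertical half-line: upwards over D_0 if [k] is 0, downwards over the region
   of index [k - 1] otherwise. *)
have [j [neg [jn jk]]] : exists j neg, (j <= n)%N /\ (j + (neg : bool))%N = k.
  case: k kn {GM} => [|k] kn; first by exists 0%N, false.
  by exists k, true; rewrite addn1.
have [x Dx] := D_nonempty R jn.
have [d [d0 dneg dM]] := far_shift (1 + pval (Phi R n) x) (M + 1) neg.
set y := rv_snoc x (pval (Phi R n) x + d).
have GP : G R n k (e_last R n + y).
  by exists y => //; rewrite -jk -dneg; exact: D_snoc.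
move: dM; rewrite ltNge => /negP; apply; apply: le_trans (GM _ GP).
rewrite -addrA -(rv_last_snoc x (pval _ _ + d)) -rv_last_e_last.
exact: coord_le_norm.
Qed.

Lemma path_connected_G k : path_connected R (G R n k).
Proof.
apply: joined_path_connected => _ _ [x Dx <-] [y Dy <-].
have [g [gc <- <- gD]] := joined_D Dx Dy.
exists (fun t => e_last R n + g t); split=> // [t|t].
  by apply: cvgD; [exact: cvg_cst|exact: gc].
by exists (g t).
Qed.

Lemma open_G k : open (G R n k).
Proof.
rewrite G_E.
apply: (open_comp (f := fun mu : 'rV[R]_n.+1 => mu - e_last R n)
  (D := D R n.+1 k)); last exact: open_D.
move=> mu _.
apply: (@continuousB _ _ _ id (cst (e_last R n)) mu); first exact: cvg_id.
exact: cst_continuous.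
Qed.

Lemma trivIset_G : trivIset setT (G R n).
Proof.
by move=> i j _ _; rewrite !G_E => -[mu [/D_cnt[_ <-] /D_cnt[_ <-]]].
Qed.

Lemma setC_V_C : ~` V (C R n) = \bigcup_(k in `I_n.+2) G R n k.
Proof.
rewrite V_C; apply/seteqP; split=> mu /=.
  move=> /eqP qmu; exists (cnt (mu - e_last R n)).
    by rewrite /= ltnS; exact: cnt_le.
  by rewrite G_E; exact/D_cnt.
by move=> [k _]; rewrite G_E => /D_cnt[/eqP].
Qed.

(** [G R n k] is connected, and it is both open and closed in the complement because the other
    regions are open too. *)
Lemma connected_component_G k x : (k <= n.+1)%N -> G R n k x ->
  connected_component (~` V (C R n)) x = G R n k.
Proof.
move=> kn Gx; apply/seteqP; split; last first.
  apply: connected_component_max => //.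
    by rewrite setC_V_C => y Gy; exists k.
  exact: path_connected_connected (@path_connected_G k).
move=> y [B [Bx BV cB] By].
suff BG : B `&` G R n k = B by move: By; rewrite -BG => -[].
apply: cB; first by exists x.
  by exists (G R n k) => //; exact: open_G.
exists (~` \bigcup_(j in [set j | j != k]) G R n j).
  by apply: open_closedC; apply: bigcup_open => j _; exact: open_G.
apply/seteqP; split=> z [Bz Gz]; split=> //.
  by move=> [j /eqP jk Gj]; apply: jk; apply: (trivIset_G I I); exists z.
have := BV _ Bz; rewrite setC_V_C => -[j _ Gj].
by have [<-//|jk] := eqVneq j k; case: Gz; exists j.
Qed.

End JostVariety.

(* The dimension, a positive integer, is n.+1. *)
Theorem theorem4p3 (R : realType) (n : nat) :
  [/\ V (C R n) = [set e_last R n + mu | mu in V (Q R n.+1)],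
      [/\ V (C R n) =
            \bigcup_(k in `I_n.+1) graph (prestrict (paddc (Phi R n) 1) (D R n k)),
          trivIset `I_n.+1
            (fun k => graph (prestrict (paddc (Phi R n) 1) (D R n k))) &
          forall k, (k <= n)%N ->
            smooth_hypersurface (graph (prestrict (paddc (Phi R n) 1) (D R n k)))] &
      [/\ ~` V (C R n) = \bigcup_(k in `I_n.+2) G R n k,
          trivIset `I_n.+2 (G R n) &
          forall k, (k <= n.+1)%N ->
            [/\ ~ bounded_set (G R n k),
                path_connected R (G R n k),
                open (G R n k) &
                forall x, G R n k x ->
                  connected_component (~` V (C R n)) x = G R n k]]].
Proof.
split; [|split|split].
- by rewrite translateE V_C.
- apply/seteqP; split=> mu; last by move=> [k _]; rewrite graph_C => -[].
  (* Consecutive terms have no common zero, so the base point lies in the region indexed by its own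
     sign count. *)
  rewrite V_C /= => qmu; have := q_eq0_init qmu.
  rewrite rv_init_translate => qx.
  exists (cnt (rv_init mu)); first by rewrite /= ltnS; exact: cnt_le.
  by rewrite graph_C /= -q_translate; split=> //; exact/D_cnt.
- move=> i j _ _; rewrite !graph_C.
  by move=> -[mu [[/D_cnt[_ <-] _] [/D_cnt[_ <-]]]].
- exact: smooth_hypersurface_graph.
- exact: setC_V_C.
- by move=> i j _ _; exact: trivIset_G.
- move=> k kn; split; [exact: unbounded_G|exact: path_connected_G| |].
    exact: open_G.
  by move=> x; exact: connected_component_G.
Qed.
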